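(* Let $(\sigma_i^2,s_i^2)$, $i=1,2,\dots$, follow the hierarchical model in which $\sigma_i^2\overset{iid}{\sim} g$ (an arbitrary prior on $(0,\infty)$) and, conditionally on the variances, the $s_i^2$ are independent with $s_i^2\mid\sigma_i^2\sim \sigma_i^2\chi_k^2/k$. Let $F$ be the marginal cumulative distribution function of $s_i^2$. Assume $$\int_0^\infty (s^2)^{-(\frac k2-2)}\,dF(s^2)<\infty\quad\text{and}\quad \int_0^\infty (s^2)^{-(\frac k2-1)}\,dF(s^2)<\infty,$$ and that $F$ is continuous with support $(0,\infty)$. For $\delta>0$ let $$\mathcal{D}^\delta=\left\{u>0:\ \int_u^\infty (s^2)^{-(\frac k2-1)}\,dF(s^2)>\delta\right\}.$$ For $u>0$, let $\hat\sigma^2_{B}(u)$ and $\hat\sigma^2_{F\text{-}EBV}(u)$ (which depends on $s_1^2,\dots,s_N^2$) denote the Bayes estimator and the F-modeling based empirical Bayes estimator defined in the context, viewed as functions of the value $u$ of the sample variance, so that $\hat\sigma^2_{i,B}=\hat\sigma^2_B(s_i^2)$ and $\hat\sigma^2_{i,F\text{-}EBV}=\hat\sigma^2_{F\text{-}EBV}(s_i^2)$. Then for every $\delta>0$, as $N\to\infty$, $$\sup_{u\in\mathcal{D}^\delta}\left|\hat\sigma^2_{F\text{-}EBV}(u)-\hat\sigma^2_{B}(u)\right|\overset{a.s.}{\longrightarrow}0.$$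
   Context: $k$ is the (known) degrees of freedom and $\chi_k^2$ denotes a chi-square random variable with $k$ degrees of freedom. With $p(s^2\mid\sigma^2)$ the density of $\sigma^2\chi_k^2/k$ and $g$ the prior density, the marginal density of the sample variances is $f(s^2)=\int_0^\infty p(s^2\mid\sigma^2)g(\sigma^2)\,d\sigma^2$, and $F(x)=\int_0^x f(s^2)\,ds^2$. In integrals, $s^2$ is treated as a single positive integration variable. The Bayes estimator at a sample variance with value $u$ is $$\hat\sigma^2_{B}(u)=\frac k2\left\{\frac{\int_u^\infty (s^2)^{-(\frac k2-2)}\,dF(s^2)}{\int_u^\infty (s^2)^{-(\frac k2-1)}\,dF(s^2)}-u\right\}.$$ The F-modeling based empirical Bayes estimator based on $s_1^2,\dots,s_N^2$, at a sample variance with value $u$, is $$\hat\sigma^2_{F\text{-}EBV}(u)=\begin{cases}u, & u\ge\max_{1\le j\le N}s_j^2,\\[4pt] \dfrac k2\left\{\dfrac{\sum_{j:\,s_j^2\ge u}(s_j^2)^{-(\frac k2-2)}}{\sum_{j:\,s_j^2\ge u}(s_j^2)^{-(\frac k2-1)}}-u\right\}, & \text{otherwise.}\end{cases}$$ The supremum over an empty set is taken to be $0$. *)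

(* Defs.v *)
From HB Require Import structures.
From mathcomp Require Import all_boot all_order all_algebra.
From mathcomp Require Import all_classical all_reals all_analysis.
From mathcomp Require Import measurable_realfun.

Set Implicit Arguments.
Unset Strict Implicit.
Unset Printing Implicit Defensive.

Import Order.TTheory GRing.Theory Num.Theory.
Import numFieldNormedType.Exports.

Local Open Scope classical_set_scope.
Local Open Scope ring_scope.

Section ScaledChiSquare.
Context {R : realType}.
Implicit Types k s v x : R.

Definition Gamma (a : R) : R :=
  \int[lebesgue_measure]_(t in `]0, +oo[) (t `^ (a - 1) * expR (- t)).

Definition chi_square_pdf k : R -> R :=
  (fun x => x `^ (k / 2 - 1) * expR (- (x / 2)) / (2 `^ (k / 2) * Gamma (k / 2)))
    \_ `]0, +oo[.

(* p(s | v): density at s of v * X / k with X chi-square; only v > 0 matters. *)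
Definition scaled_chi_square_pdf k v s : R :=
  k / v * chi_square_pdf k (k * s / v).

Definition scaled_chi_square k v (B : set R) : \bar R :=
  (\int[lebesgue_measure]_(s in B) (scaled_chi_square_pdf k v s)%:E)%E.

End ScaledChiSquare.

Section Marginal.
Context {R : realType}.
Variables (k : R) (g : probability (measurableTypeR R) R).

Definition marginal_pdf (s : R) : \bar R :=
  (\int[g]_(v in `]0%R, +oo[) (scaled_chi_square_pdf k v s)%:E)%E.

Definition marginal_cdf (x : R) : \bar R :=
  (\int[lebesgue_measure]_(s in `]0%R, x]) marginal_pdf s)%E.

End Marginal.

Section HierarchicalModel.
Context {d : measure_display} {T : measurableType d} {R : realType}.
Variable P : probability T R.

Definition mutually_independent (X : nat -> {RV P >-> R}) : Prop :=
  forall (J : seq nat) (A : nat -> set R), uniq J ->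
    (forall i, measurable (A i)) ->
    P (\bigcap_(i in [set` J]) X i @^-1` A i) =
    (\prod_(i <- J) P (X i @^-1` A i))%E.

Definition sigma_generated (X : nat -> {RV P >-> R}) : set (set T) :=
  <<s [set C | exists i, exists2 B : set R, measurable B & C = X i @^-1` B] >>.

(* Y is a version of the conditional probability of E given the
   sub-sigma-algebra S. *)
Definition is_cond_prob (S : set (set T)) (E : set T) (Y : T -> \bar R) : Prop :=
  (forall B : set (\bar R), measurable B -> S (Y @^-1` B)) /\
  (forall A, S A -> P (A `&` E) = (\int[P]_(w in A) Y w)%E).

(* The last clause states both the conditional independence of the s2 i and
   the conditional law of each: take J = [:: i] for the latter. *)
Definition hierarchical_model (k : R) (g : probability (measurableTypeR R) R)
    (sigma2 s2 : nat -> {RV P >-> R}) : Prop :=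
  [/\ mutually_independent sigma2,
      (forall i A, measurable A -> distribution P (sigma2 i) A = g A) &
      forall (J : seq nat) (B : nat -> set R), uniq J ->
        (forall i, measurable (B i)) ->
        is_cond_prob (sigma_generated sigma2)
          (\bigcap_(i in [set` J]) s2 i @^-1` B i)
          (fun w => \prod_(i <- J) scaled_chi_square k (sigma2 i w) (B i))%E].

End HierarchicalModel.

Section Estimators.
Context {R : realType}.

Definition has_support (mu : set R -> \bar R) (A : set R) : Prop :=
  mu (~` A) = 0%E /\
  (forall U : set R, open U -> U !=set0 -> U `<=` A -> (0 < mu U)%E).

Definition bayes_est (k : R) (F : cumulative R R) (u : R) : R :=
  k / 2 *
  ((\int[lebesgue_stieltjes_measure F]_(s in `]u, +oo[) s `^ (- (k / 2 - 2))) /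
   (\int[lebesgue_stieltjes_measure F]_(s in `]u, +oo[) s `^ (- (k / 2 - 1)))
   - u).

(* The sample is x 0, ..., x N.-1; for N > 0 the default x 0 of the maximum is
   one of its values, so it does not affect the maximum. *)
Definition F_EBV_est (k : R) (N : nat) (x : nat -> R) (u : R) : R :=
  if \big[Num.max/x 0%N]_(j < N) x j <= u then u
  else k / 2 *
    ((\sum_(j < N | u <= x j) x j `^ (- (k / 2 - 2))) /
     (\sum_(j < N | u <= x j) x j `^ (- (k / 2 - 1)))
     - u).

Definition D_delta (k : R) (F : cumulative R R) (delta : R) : set R :=
  [set u | 0 < u /\
    (delta%:E < \int[lebesgue_stieltjes_measure F]_(s in `]u, +oo[)
                  (s `^ (- (k / 2 - 1)))%:E)%E].

(* The library gives ereal_sup set0 = -oo; here the empty supremum is 0. *)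
Definition sup_over (D : set R) (h : R -> R) : \bar R :=
  if D == set0 then 0%E else ereal_sup [set (h u)%:E | u in D].

End Estimators.

(* Main.v *)
Require Import Defs.
From HB Require Import structures.
From mathcomp Require Import all_boot all_order all_algebra.
From mathcomp Require Import all_classical all_reals all_analysis.
From mathcomp Require Import measurable_realfun.
From mathcomp Require Import ring lra.

(** Divide numerator and denominator of the empirical estimator by N: both
    become tail means, averages over the sample of s `^ p restricted to s >= u,
    with p = - (k / 2 - 2) and p = - (k / 2 - 1). The Bayes estimator is the same
    expression in the corresponding tail expectations, so it suffices that tail
    means converge to tail expectations almost surely and uniformly in u, the
    denominator being larger than delta on the set D_delta.

    The sample is i.i.d. with law dF. Conditioning on the variances writes the
    probability of a joint event as the expectation of a product of kernels
    evaluated at independent variances (law_mixture); hence the sample is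
    pairwise independent, and Tonelli identifies the common law with the measure
    of density marginal_pdf, that is with dF (law_sample_stieltjes).

    Only first moments are finite, so pointwise convergence needs the strong law
    under integrability alone. It is proved in Etemadi's way, which uses no more
    than pairwise independence (strong_law_pairwise): along c = j * 2 ^ n, the
    variables truncated at level c have averages whose variances are summable
    over n, and the truncation changes only finitely many of the sums; both facts
    rest on geometric sums dominated by 2 x. Since the summands are
    nonnegative, convergence along j * 2 ^ n for every fixed j > 0 forces
    convergence along all N (cvg_mean_dyadic).

    Uniformity is Polya's argument (polya_uniform): tail means are monotone in u,
    their limit is continuous because the law has a density, and D_delta lies in
    a bounded interval because tail expectations vanish at infinity.
    The same argument gives a positive tail mean at some q > u, hence a
    sample point beyond u, which excludes the degenerate branch of the
    empirical estimator. *)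

Set Implicit Arguments.
Unset Strict Implicit.
Unset Printing Implicit Defensive.

Import Order.TTheory GRing.Theory Num.Theory.
Import numFieldNormedType.Exports.

Local Open Scope classical_set_scope.
Local Open Scope ring_scope.

(** * Averages along dyadic indices *)

Section DyadicSums.
Context {R : realType}.
Implicit Types (x : R) (j : nat).

Local Notation c j n := ((j * 2 ^ n)%N%:R : R).

Lemma dyadicS j n : c j n.+1 = 2 * c j n.
Proof. by rewrite expnS mulnCA natrM. Qed.

Lemma dyadic_gt0 j n : (0 < j)%N -> 0 < c j n.
Proof. by move=> j0; rewrite ltr0n muln_gt0 j0 expn_gt0. Qed.

(** Terms double at each step, so the sum is controlled by its last term. It is
    what bounds the expected number of values above the truncation levels. *)
Lemma sum_dyadic_below j x N : (0 < j)%N -> 0 <= x ->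
  \sum_(n < N) (if c j n < x then c j n else 0) <= 2 * x.
Proof.
move=> j0 x0.
(* The bound by c j N is what makes the induction go through. *)
suff /andP[] : (\sum_(n < N) (if c j n < x then c j n else 0) <= 2 * x) &&
    (\sum_(n < N) (if c j n < x then c j n else 0) <= c j N) by [].
elim: N => [|N /andP[IH1 IH2]].
  by rewrite big_ord0 mulr_ge0// ler0n.
rewrite big_ord_recr/= dyadicS; have := dyadic_gt0 N j0.
move: (\sum_(n < N) _) (c j N) IH1 IH2 => S C IH1 IH2.
by move=> C0; case: (ltP C x) => xC; apply/andP; split; lra.
Qed.

(** Mirror image of the previous sum: a geometric series dominated by its first
    term, the one with c j n just above x. It bounds the variances of truncated
    averages. *)
Lemma sum_dyadic_above j x N : (0 < j)%N -> 0 <= x ->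
  \sum_(n < N) (if x <= c j n then x ^+ 2 / c j n else 0) <= 2 * x.
Proof.
move=> j0; rewrite le_eqVlt => /predU1P[<-|x0].
  rewrite mulr0 big1// => i _; case: ifP => // _.
  by rewrite expr0n mul0r.
(* The added term is the whole remaining tail of the geometric series. *)
suff : \sum_(n < N) (if x <= c j n then x ^+ 2 / c j n else 0) +
    2 * (x ^+ 2 / Num.max x (c j N)) <= 2 * x.
  apply: le_trans; rewrite lerDl mulr_ge0// divr_ge0//.
    by rewrite sqr_ge0.
  by rewrite le_max ltW.
elim: N => [|N IH].
  rewrite big_ord0 add0r ler_pM2l// ler_pdivrMr ?expr2 ?ler_pM2l//.
    by rewrite le_max lexx.
  by rewrite lt_max x0.
rewrite big_ord_recr/=; apply: le_trans IH; rewrite -addrA lerD2l dyadicS.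
have := dyadic_gt0 N j0; move: (c j N) => C C0.
have [xC|Cx] := leP x C.
  rewrite (max_idPr _); last by lra.
  rewrite le_eqVlt; apply/orP; left; apply/eqP; field; exact: lt0r_neq0.
rewrite add0r ler_pM2l// ler_pM2l ?exprn_gt0//.
by rewrite lef_pV2 ?posrE ?lt_max ?x0// le_max lexx.
Qed.

(** Consecutive multiples j * 2 ^ n and j.+1 * 2 ^ n have a ratio close to 1 as
    soon as j >= m, while j < 2 * m leaves finitely many values of j. *)
Lemma dyadic_bracket m N : (0 < m)%N -> (m <= N)%N ->
  exists n, exists2 j, (m <= j < 2 * m)%N & (j * 2 ^ n <= N < j.+1 * 2 ^ n)%N.
Proof.
move=> m0 mN; have q0 : (0 < N %/ m)%N by rewrite divn_gt0.
have /andP[l1 l2] := trunc_log_bounds (isT : (1 < 2)%N) q0.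
set n := trunc_log 2 (N %/ m) in l1 l2.
have n0 : (0 < 2 ^ n)%N by rewrite expn_gt0.
exists n; exists (N %/ 2 ^ n)%N; last by rewrite leq_trunc_div ltn_ceil.
rewrite leq_divRL// ltn_divLR// -mulnA [(m * 2 ^ n)%N]mulnC mulnA -expnS.
by rewrite -leq_divRL// l1 -ltn_divLR.
Qed.

End DyadicSums.

Section DyadicInterpolation.
Context {R : realType}.

(** Here s is a monotone sum at N, and A and B are the same sum at the two
    neighbouring multiples of p. The hypothesis on j makes one extra block p
    cost at most e times N. *)
Lemma dyadic_sandwich (l e s A B p N : R) (j : nat) : 0 < e -> 0 < p -> 0 <= s ->
  j%:R * p <= N -> N <= j.+1%:R * p -> `|l| + e <= e * j%:R ->
  A <= s -> s <= B -> (l - e) * (j%:R * p) <= A -> B <= (l + e) * (j.+1%:R * p) ->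
  (l - 2 * e) * N <= s <= (l + 2 * e) * N.
Proof.
move=> e0 p0 s0; rewrite -natr1 mulrDl mul1r.
set c := j%:R * p => cN Nc je As sB lA lB.
have ep : (`|l| + e) * p <= e * c by rewrite mulrA ler_pM2r.
have l1 : (l + e) * p <= e * c.
  by apply: le_trans ep; rewrite ler_pM2r// lerD2r ler_norm.
have l2 : (l - e) * p <= e * c.
  by apply: le_trans ep; rewrite ler_pM2r//; have := ler_norm l; lra.
have c0 : 0 <= c by rewrite mulr_ge0// ltW.
apply/andP; split; last first.
  apply: (@le_trans _ _ ((l + 2 * e) * c)).
    apply: (le_trans sB); apply: (le_trans lB); lra.
  case: (leP 0 (l + 2 * e)) => le0; first by rewrite ler_wpM2l.
  have : (l + 2 * e) * c <= 0 by rewrite mulr_le0_ge0// ltW.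
  have : 0 <= (l + 2 * e) * c by lra.
  move=> h1 h2. 
  nra.
have [le0|le0] := leP 0 (l - 2 * e).
  apply: (@le_trans _ _ ((l - 2 * e) * (c + p))); first by rewrite ler_wpM2l.
  apply: le_trans As; apply: le_trans lA.
  rewrite mulrDr; nra.
apply: le_trans s0; rewrite mulr_le0_ge0 ?(ltW le0)//; exact: le_trans cN.
Qed.

(** Monotonicity of the partial sums replaces the sequence of integer parts of
    alpha ^ n in Etemadi's proof: multiples of powers of 2 are arbitrarily dense
    in ratio, and no rounding occurs. *)
Lemma cvg_mean_dyadic (x : nat -> R) (l : R) : (forall i, 0 <= x i) ->
  (forall j, (0 < j)%N ->
    (\sum_(i < j * 2 ^ n) x i) / (j * 2 ^ n)%:R @[n --> \oo] --> l) ->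
  (\sum_(i < N) x i) / N%:R @[N --> \oo] --> l.
Proof.
move=> x0 cvx.
pose S N := \sum_(i < N) x i.
have S0 N : 0 <= S N by exact: sumr_ge0.
have ndS a b : (a <= b)%N -> S a <= S b.
  move=> ab; rewrite /S -!(big_mkord xpredT x) (big_cat_nat (leq0n a) ab)/=.
  by rewrite lerDl sumr_ge0.
apply/cvgrPdist_le => eps eps0; pose e := eps / 2.
have e0 : 0 < e by rewrite divr_gt0.
pose m := (Num.truncn ((`|l| + e) / e)).+1.
have me : `|l| + e <= e * m%:R.
  by rewrite mulrC -ler_pdivrMr// ltW// truncnS_gt.
have [n0 _ Hn0] : \forall n \near \oo, forall j : 'I_(2 * m).+1, (0 < j)%N ->
    `|l - S (j * 2 ^ n)%N / (j * 2 ^ n)%:R| <= e.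
  apply: filter_forall => j; case: (posnP j) => [->|j0]; first by near=> n.
  by have /cvgrPdist_le/(_ e e0) := cvx j j0; apply: filterS.
exists (2 * m * 2 ^ n0)%N => // N/= leN.
have mN : (m <= N)%N.
  apply: leq_trans leN; rewrite mulnAC -[leqLHS]mul1n leq_mul2r.
  by rewrite muln_gt0 expn_gt0 orbT.
have [n [j /andP[mj j2m] /andP[jN Nj]]] := dyadic_bracket (isT : (0 < m)%N) mN.
have n0n : (n0 <= n)%N.
  rewrite ltnW// -(ltn_exp2l _ _ (isT : (1 < 2)%N)).
  rewrite -(@ltn_pmul2l (2 * m)) ?muln_gt0//.
  apply: leq_ltn_trans leN _; apply: (leq_trans Nj).
  by rewrite leq_mul2r j2m orbT.
have Nge0 : 0 < N%:R :> R by rewrite ltr0n (leq_trans _ mN).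
have cj (i : nat) : (0 < i)%N -> (i < (2 * m).+1)%N ->
    (l - e) * (i%:R * (2 ^ n)%:R) <= S (i * 2 ^ n)%N /\
    S (i * 2 ^ n)%N <= (l + e) * (i%:R * (2 ^ n)%:R).
  move=> i0 im; have := Hn0 n n0n (Ordinal im) i0; rewrite /= ler_distlC.
  have c0 : 0 < i%:R * (2 ^ n)%:R :> R.
    by rewrite -natrM ltr0n muln_gt0 i0 expn_gt0.
  by rewrite natrM ler_pdivlMr// ler_pdivrMr// => /andP[].
have [A1 _] := cj j (leq_trans (isT : (0 < m)%N) mj) (leqW j2m).
have [_ B1] := cj j.+1 isT j2m.
have /andP[h1 h2] : (l - 2 * e) * N%:R <= S N <= (l + 2 * e) * N%:R.
  have p0 : 0 < (2 ^ n)%:R :> R by rewrite ltr0n expn_gt0.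
  apply: (dyadic_sandwich e0 p0 (S0 N) _ _ _ _ _ A1 B1).
  - by rewrite -natrM ler_nat.
  - by rewrite -natrM ler_nat ltnW.
  - by apply: le_trans me _; rewrite ler_pM2l// ler_nat.
  - exact: ndS.
  - by apply: ndS; exact: ltnW.
rewrite ler_distlC ler_pdivlMr// ler_pdivrMr//.
by rewrite (_ : eps = 2 * e) ?h1 ?h2// /e mulrC divfK.
Unshelve. all: by end_near. Qed.

End DyadicInterpolation.

(** * Independent pairs and variances *)

Section Independence.
Context d (T : measurableType d) (R : realType) (P : probability T R).
Local Open Scope ereal_scope.

Definition independent_pair d1 d2 (T1 : measurableType d1)
    (T2 : measurableType d2) (X : {RV P >-> T1}) (Y : {RV P >-> T2}) :=
  forall A B, measurable A -> measurable B ->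
    P (X @^-1` A `&` Y @^-1` B) = P (X @^-1` A) * P (Y @^-1` B).

(** The joint law of (X, Y) is the product of the laws, because both agree on
    rectangles; Tonelli then factors the integral. *)
Lemma ge0_integral_independentM d1 d2 (T1 : measurableType d1)
    (T2 : measurableType d2) (X : {RV P >-> T1}) (Y : {RV P >-> T2})
    (f : T1 -> \bar R) (g : T2 -> \bar R) :
  independent_pair X Y ->
  measurable_fun [set: T1] f -> measurable_fun [set: T2] g ->
  (forall x, 0 <= f x) -> (forall y, 0 <= g y) ->
  \int[P]_w (f (X w) * g (Y w)) = \int[P]_w f (X w) * \int[P]_w g (Y w).
Proof.
move=> XY mf mg f0 g0.
pose Z w := (X w, Y w).
have mZ : measurable_fun [set: T] Z by apply: measurable_fun_pair.
pose Zm := isMeasurableFun.Build _ _ _ _ Z mZ.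
pose Z' : {mfun T >-> (T1 * T2)%type} := HB.pack Z Zm.
have lawE A : measurable A ->
    (distribution P X \x distribution P Y) A = distribution P Z' A.
  by apply: product_measure_unique => B C mB mC; exact: XY.
pose F (z : T1 * T2) := f z.1 * g z.2.
have mF : measurable_fun [set: T1 * T2] F.
  by apply: emeasurable_funM; exact: measurableT_comp.
have F0 z : 0 <= F z by rewrite mule_ge0.
transitivity (\int[distribution P Z']_z F z).
  by rewrite ge0_integral_distribution.
transitivity (\int[distribution P X \x distribution P Y]_z F z).
  by apply: eq_measure_integral => A mA _; rewrite [RHS]lawE.
rewrite fubini_tonelli1// /fubini_F /F/=.
under eq_integral do rewrite ge0_integralZl//.
rewrite ge0_integralZr//; last exact: integral_ge0.
by rewrite !ge0_integral_distribution.
Qed.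

Lemma bounded_Lfun (f : T -> R) (M p : R) : (1 <= p)%R ->
  measurable_fun [set: T] f -> (forall w, `|f w| <= M)%R -> f \in Lfun P p%:E.
Proof.
move=> p1 mf fM; rewrite inE/=; apply/andP; split; rewrite inE//=.
rewrite /finite_norm unlock poweR_lty//.
apply: (@le_lt_trans _ _ (\int[P]_w (cst (M `^ p)%:E w))); last first.
  by apply/integrable_lty => //; exact: finite_measure_integrable_cst.
apply: ge0_le_integral => //.
- by move=> w _; exact: poweR_ge0.
- apply: (measurableT_comp (measurable_poweR _)) => //.
  by apply/measurable_EFinP; exact: measurableT_comp.
- move=> w _ /=; rewrite lee_fin; apply: ge0_ler_powR => //.
  + exact: le_trans p1.
  + by rewrite nnegrE (le_trans _ (fM w)).
Qed.

Lemma variance_sum_uncorrelated (Y : nat -> T -> R) n :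
  (forall i, Y i \in Lfun P 2%:E) ->
  (forall i j, i != j -> covariance P (Y i) (Y j) = 0) ->
  'V_P[(\sum_(i < n) Y i)%R] = \sum_(i < n) 'V_P[Y i].
Proof.
move=> Y2 Y0.
have S2 m : (\sum_(i < m) Y i)%R \in Lfun P 2%:E.
  by apply: rpred_sum => // *; rewrite lee1n.
have SY m k : (m <= k)%N -> covariance P (\sum_(i < m) Y i)%R (Y k) = 0.
  elim: m => [|m IH] mk; first by rewrite big_ord0 (covariance_cst_l P 0%R).
  rewrite big_ord_recr/= (covarianceDl (S2 m))// Y0 ?neq_ltn ?mk//.
  by rewrite IH ?adde0// ltnW.
elim: n => [|n IH].
  by rewrite !big_ord0 (variance_cst P 0%R).
by rewrite !big_ord_recr/= (varianceD (S2 n))// IH SY// mule0 adde0.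
Qed.

End Independence.

Lemma sume_const_ord (R : realDomainType) (a : \bar R) n :
  (\sum_(i < n) a = n%:R%:E * a)%E.
Proof.
elim: n => [|n IH]; first by rewrite big_ord0 mul0e.
by rewrite big_ord_recr/= IH -natr1 EFinD ge0_muleDl// ?mul1e// lee_fin.
Qed.

Section PairwiseIID.
Context d (T : measurableType d) (R : realType) (P : probability T R).
Local Open Scope ereal_scope.

Definition pairwise_independent (X : nat -> {RV P >-> R}) :=
  forall i j, i != j -> independent_pair (X i) (X j).

Definition identically_distributed (X : nat -> {RV P >-> R}) :=
  forall i A, measurable A -> P (X i @^-1` A) = P (X 0%N @^-1` A).

Variable X : nat -> {RV P >-> R}.
Hypothesis Xind : pairwise_independent X.
Hypothesis Xid : identically_distributed X.

Lemma ge0_integral_identically_distributed (f : R -> \bar R) i :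
  measurable_fun [set: R] f -> (forall x, 0 <= f x) ->
  \int[P]_w f (X i w) = \int[P]_w f (X 0%N w).
Proof.
move=> mf f0.
transitivity (\int[distribution P (X i)]_x f x).
  by rewrite ge0_integral_distribution.
transitivity (\int[distribution P (X 0%N)]_x f x).
  by apply: eq_measure_integral => A mA _; exact: Xid.
by rewrite ge0_integral_distribution.
Qed.

(** The left-hand side is a variance; pairwise independence makes the variance of
    the sum additive. The bound M provides square integrability. *)
Lemma integral_sqr_mean_centered (f : R -> R) (M : R) n : (0 < n)%N ->
  measurable_fun [set: R] f -> (forall x, 0 <= f x)%R -> (forall x, f x <= M)%R ->
  \int[P]_w (((\sum_(i < n) f (X i w)) / n%:R -
               fine (\int[P]_w (f (X 0%N w))%:E)) ^+ 2)%:E <=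
  \int[P]_w ((f (X 0%N w)) ^+ 2 / n%:R)%:E.
Proof.
move=> n0 mf f0 fM; set m := fine _.
have mfe : measurable_fun [set: R] (EFin \o f) by exact/measurable_EFinP.
pose Y i := f \o X i.
have mY i : measurable_fun [set: T] (Y i) by exact: measurableT_comp.
have YL p i : (1 <= p)%R -> Y i \in Lfun P p%:E.
  move=> p1; apply: (@bounded_Lfun _ _ _ P _ M) => // w.
  by rewrite ger0_norm /Y/=.
have Y2 i : Y i \in Lfun P 2%:E by apply: YL; rewrite ler1n.
have Y1 i : Y i \in Lfun P 1 by apply: YL.
have EY i : 'E_P[Y i] = \int[P]_w (f (X 0%N w))%:E.
  by rewrite unlock; exact: (@ge0_integral_identically_distributed (EFin \o f)).
have finE : \int[P]_w (f (X 0%N w))%:E \is a fin_num.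
  by rewrite -(EY 0%N) expectation_fin_num.
have cov0 i j : i != j -> covariance P (Y i) (Y j) = 0.
  move=> ij; rewrite covarianceE//; last exact: Lfun2_mul_Lfun1.
  have -> : 'E_P[(Y i * Y j)%R] = 'E_P[Y i] * 'E_P[Y j].
    rewrite unlock -(@ge0_integral_independentM _ _ _ P _ _ _ _ (X i) (X j)
      (EFin \o f) (EFin \o f))//=.
    exact: Xind.
  by rewrite subee// !EY fin_numM.
pose Z := (n%:R^-1 \o* (\sum_(i < n) Y i))%R.
have ZE w : Z w = ((\sum_(i < n) f (X i w)) / n%:R)%R.
  by rewrite /Z/= fct_sumE mulrC.
have EZ : 'E_P[Z] = \int[P]_w (f (X 0%N w))%:E.
  rewrite unlock.
  under eq_integral do rewrite ZE mulrC EFinM -sumEFin.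
  rewrite ge0_integralZl//; last 2 first.
  - by apply: emeasurable_sum => i; exact: (measurableT_comp mfe).
  - by move=> w _; apply: sume_ge0 => i _; rewrite lee_fin.
  rewrite ge0_integral_sum//; last 2 first.
  - by move=> i; exact: (measurableT_comp mfe).
  - by move=> i w _; rewrite lee_fin.
  under eq_bigr do rewrite (@ge0_integral_identically_distributed (EFin \o f))//.
  rewrite sume_const_ord -(fineK finE) -!EFinM mulrA.
  by rewrite mulVf ?mul1r// pnatr_eq0 -lt0n.
have -> : \int[P]_w (((\sum_(i < n) f (X i w)) / n%:R - m) ^+ 2)%:E = 'V_P[Z].
  rewrite /variance covariance.unlock EZ expectation.unlock.
  apply: eq_integral => w _ /=.
  by rewrite -ZE.
rewrite varianceZ; last by apply: rpred_sum => // *; rewrite lee1n.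
rewrite (variance_sum_uncorrelated n Y2 cov0).
have VY i : 'V_P[Y i] <= \int[P]_w ((f (X 0%N w)) ^+ 2)%:E.
  rewrite varianceE// -[leRHS]adde0 leeD//; last first.
    by rewrite oppe_le0 EY -(fineK finE) -EFin_expe lee_fin sqr_ge0.
  rewrite unlock.
  rewrite -(@ge0_integral_identically_distributed
    (EFin \o (fun x => f x ^+ 2)%R) i)//=.
  - by apply/measurable_EFinP; exact: measurable_funX.
  - by move=> x; rewrite lee_fin sqr_ge0.
under [leRHS]eq_integral do rewrite mulrC EFinM.
rewrite ge0_integralZl//; last 2 first.
- by apply/measurable_EFinP/measurable_funX; exact: mY.
- by move=> w _; rewrite lee_fin sqr_ge0.
have n0' : n%:R != 0%R :> R by rewrite pnatr_eq0 -lt0n.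
rewrite expr2 EFinM -muleA lee_pmul2l// ?lte_fin ?invr_gt0 ?ltr0n//.
rewrite muleC lee_pdivrMr ?ltr0n//.
apply: (@le_trans _ _ (\sum_(i < n) \int[P]_w ((f (X 0%N w)) ^+ 2)%:E)%E).
  by apply: lee_sum => i _; exact: VY.
by rewrite sume_const_ord muleC.
Qed.

End PairwiseIID.

(** * The strong law of large numbers for pairwise independent variables *)

Section SummableTerms.
Local Open Scope ereal_scope.

Lemma nneseries_le_bound (R : realType) (u : nat -> \bar R) (b : \bar R) :
  (forall n, 0 <= u n) -> (forall N, \sum_(n < N) u n <= b) ->
  \sum_(n <oo) u n <= b.
Proof.
move=> u0 ub; apply: lime_le; first by apply: is_cvg_nneseries.
by near=> N; rewrite big_mkord.
Unshelve. all: by end_near. Qed.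

Lemma measurable_nneseries d (T : measurableType d) (R : realType)
    (f : nat -> T -> \bar R) : (forall n, measurable_fun [set: T] (f n)) ->
  (forall n x, 0 <= f n x) ->
  measurable_fun [set: T] (fun x => \sum_(n <oo) f n x).
Proof.
move=> mf f0.
exact: (@ge0_emeasurable_sum _ _ _ setT f xpredT (fun n x _ _ => f0 n x)).
Qed.

(** This replaces the Chebyshev inequality and the Borel-Cantelli lemma: by
    monotone convergence the series of the g n is integrable, so it is finite
    almost everywhere and its terms tend to 0. *)
Lemma ae_cvg0_summable d (T : measurableType d) (R : realType)
    (mu : {measure set T -> \bar R}) (g : nat -> T -> R) :
  (forall n, measurable_fun [set: T] (g n)) -> (forall n w, 0 <= g n w)%R ->
  \sum_(n <oo) \int[mu]_w (g n w)%:E < +oo ->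
  {ae mu, forall w, (g n w @[n --> \oo] --> 0)%R}.
Proof.
move=> mg g0 gfin.
have mge n : measurable_fun [set: T] (EFin \o g n) by exact/measurable_EFinP.
pose G w := \sum_(n <oo) (g n w)%:E.
have G0 w : 0 <= G w by apply: nneseries_ge0 => n _ _; rewrite lee_fin.
have iG : mu.-integrable [set: T] G.
  apply/integrableP; split.
    by apply: measurable_nneseries => // n w; rewrite lee_fin.
  under eq_integral do rewrite gee0_abs//.
  by rewrite integral_nneseries// => n w _; rewrite lee_fin.
have := integrable_ae measurableT iG; apply: filterS => w /(_ I) Gw.
have Gfin : \sum_(n <oo) (g n w)%:E < +oo by rewrite ltey_eq -/(G w) Gw.
have tail0 := nneseries_tail_cvg Gfin (fun n _ => g0 n w : 0 <= (g n w)%:E).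
suff : (g n w)%:E @[n --> \oo] --> 0%R%:E by move/fine_cvg.
apply/(@squeeze_cvge _ _ _ _ (cst 0) _
  (fun n => \sum_(n <= k <oo) (g k w)%:E)) => //.
  near=> n; rewrite lee_fin g0/=.
  have := @nneseries_lim_ge _ (fun k => (g k w)%:E) xpredT n n.+1.
  by rewrite big_nat1; apply=> k _ _; rewrite lee_fin.
exact: cvg_cst.
Unshelve. all: by end_near. Qed.

End SummableTerms.

Section StrongLaw.
Context d (T : measurableType d) (R : realType) (P : probability T R).
Variable X : nat -> {RV P >-> R}.
Hypothesis Xind : pairwise_independent X.
Hypothesis Xid : identically_distributed X.
Variable h : R -> R.
Hypothesis mh : measurable_fun [set: R] h.
Hypothesis h0 : forall x, 0 <= h x.
Hypothesis hfin : (\int[P]_w (h (X 0%N w))%:E < +oo)%E.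

Let trunc (a x : R) := if h x <= a then h x else 0.

Let mtrunc a : measurable_fun [set: R] (trunc a).
Proof.
by apply: measurable_fun_ifT => //; apply: measurable_fun_ler.
Qed.

Let trunc_ge0 a x : 0 <= trunc a x.
Proof. by rewrite /trunc; case: ifP. Qed.

Let mhX i : measurable_fun [set: T] (fun w => h (X i w)).
Proof. exact: measurableT_comp. Qed.

Let cvg_mean_trunc (c : nat -> R) : c n @[n --> \oo] --> +oo ->
  fine (\int[P]_w (trunc (c n) (X 0%N w))%:E) @[n --> \oo] -->
  fine (\int[P]_w (h (X 0%N w))%:E).
Proof.
move=> cy.
have ih : P.-integrable [set: T] (fun w => (h (X 0%N w))%:E).
  apply/integrableP; split; first exact/measurable_EFinP.
  by under eq_integral do rewrite gee0_abs ?lee_fin//.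
apply: fine_cvg; rewrite fineK; last exact: integrable_fin_num.
have [//|||||_ _] := @dominated_convergence _ _ _ P _ measurableT
  (fun n w => (trunc (c n) (X 0%N w))%:E) (fun w => (h (X 0%N w))%:E)
  (fun w => (h (X 0%N w))%:E).
- by move=> n; apply/measurable_EFinP; exact: (measurableT_comp (mtrunc _)).
- exact/measurable_EFinP.
- apply: aeW => w _; apply: cvg_near_cst.
  have : \forall n \near \oo, h (X 0%N w) <= c n by move/cvgryPge : cy; exact.
  by apply: filterS => n hn; rewrite /trunc hn.
- exact: ih.
- apply: aeW => w n _; rewrite gee0_abs ?lee_fin// /trunc.
  by case: ifP.
by [].
Qed.

(** At stage n all c n variables are truncated at the level c n. D n is
    the squared error of the truncated average and E n counts the values above
    the level; both have summable expectations, whose sums are bounded by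
    twice the expectation of h (X 0). *)
Lemma strong_law_dyadic j : (0 < j)%N -> {ae P, forall w,
  (\sum_(i < j * 2 ^ n) h (X i w)) / (j * 2 ^ n)%:R @[n --> \oo] -->
  fine (\int[P]_w (h (X 0%N w))%:E)}.
Proof.
move=> j0.
pose c n := (j * 2 ^ n)%N; pose cR n : R := (c n)%:R.
have c0 n : 0 < cR n by exact: dyadic_gt0.
pose t n := trunc (cR n).
pose m n := fine (\int[P]_w (t n (X 0%N w))%:E).
pose D n w := ((\sum_(i < c n) t n (X i w)) / cR n - m n) ^+ 2.
pose e n x : R := if cR n < h x then 1 else 0.
pose E n w := \sum_(i < c n) e n (X i w).
have me n : measurable_fun [set: R] (e n).
  by apply: measurable_fun_ifT => //; apply: measurable_fun_ltr.
have e0 n x : 0 <= e n x by rewrite /e; case: ifP.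
have bound2h (f : nat -> R -> R) : (forall n, measurable_fun [set: R] (f n)) ->
    (forall n x, 0 <= f n x) -> (forall N x, \sum_(n < N) f n x <= 2 * h x) ->
    (\sum_(n <oo) \int[P]_w (f n (X 0%N w))%:E < +oo)%E.
  move=> mf f0 f2.
  have mfX n : measurable_fun [set: T] (fun w => (f n (X 0%N w))%:E).
    by apply/measurable_EFinP; exact: measurableT_comp.
  rewrite -integral_nneseries//; last by move=> *; rewrite lee_fin.
  apply: (@le_lt_trans _ _ (\int[P]_w (2%:E * (h (X 0%N w))%:E))%E); last first.
    rewrite ge0_integralZl//; last 2 first.
    - exact/measurable_EFinP.
    - by move=> *; rewrite lee_fin.
    by rewrite lte_mul_pinfty// lee_fin.
  apply: ge0_le_integral => //.
  - by move=> w _; apply: nneseries_ge0 => *; rewrite lee_fin.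
  - by apply: measurable_nneseries => // *; rewrite lee_fin.
  - by apply/measurable_EFinP; exact: measurable_funM.
  - move=> w _; apply: nneseries_le_bound => [n|N]; first by rewrite lee_fin.
    by rewrite sumEFin -EFinM lee_fin.
have aeD : {ae P, forall w, D n w @[n --> \oo] --> 0}.
  apply: ae_cvg0_summable.
  - move=> n; apply: measurable_funX; apply: measurable_funB => //.
    apply: measurable_funM => //; apply: measurable_sum => i.
    exact: (measurableT_comp (mtrunc _)).
  - by move=> n w; exact: sqr_ge0.
  apply: (@le_lt_trans _ _
      (\sum_(n <oo) \int[P]_w ((t n (X 0%N w)) ^+ 2 / cR n)%:E)%E).
    apply: lee_nneseries => n _.
      by move=> _; apply: integral_ge0 => w _; rewrite lee_fin sqr_ge0.
    apply: (@integral_sqr_mean_centered _ _ _ _ X Xind Xid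
      (t n) (cR n) (c n)) => //.
    - by have := c0 n; rewrite ltr0n.
    - exact: mtrunc.
    - by move=> x; exact: trunc_ge0.
    - by move=> x; rewrite /t /trunc; case: ifP => // _; exact: (ltW (c0 n)).
  apply: (bound2h (fun n x => (t n x) ^+ 2 / cR n)) => [n|n x|N x].
  - by apply: measurable_funM => //; apply: measurable_funX; exact: mtrunc.
  - by rewrite divr_ge0// ?sqr_ge0// ltW.
  - apply: le_trans (sum_dyadic_above N j0 (h0 x)).
    apply: ler_sum => n _; rewrite /t /trunc -/(c n) -/(cR n).
    by case: ifP => // _; rewrite expr0n mul0r.
have aeE : {ae P, forall w, E n w @[n --> \oo] --> 0}.
  apply: ae_cvg0_summable.
  - by move=> n; apply: measurable_sum => i; exact: measurableT_comp.
  - by move=> n w; exact: sumr_ge0.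
  have Ei n i : (\int[P]_w (e n (X i w))%:E = \int[P]_w (e n (X 0%N w))%:E)%E.
    apply: (@ge0_integral_identically_distributed _ _ _ _ X Xid
      (EFin \o e n)) => [|x].
      exact/measurable_EFinP.
    by rewrite lee_fin.
  have EE n : (\int[P]_w (E n w)%:E = \int[P]_w (cR n * e n (X 0%N w))%:E)%E.
    under eq_integral do rewrite -sumEFin.
    rewrite ge0_integral_sum//; last 2 first.
    - by move=> i; apply/measurable_EFinP; exact: measurableT_comp.
    - by move=> i w _; rewrite lee_fin.
    under eq_bigr do rewrite Ei.
    rewrite sume_const_ord -ge0_integralZl//.
    - by apply/measurable_EFinP; exact: measurableT_comp.
    - by move=> w _; rewrite lee_fin.
  under eq_eseriesr do rewrite EE.
  apply: (bound2h (fun n x => cR n * e n x)) => [n|n x|N x].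
  - by apply: measurable_funM.
  - by rewrite mulr_ge0// ltW.
  - apply: le_trans (sum_dyadic_below N j0 (h0 x)).
    apply: ler_sum => n _; rewrite /e -/(c n) -/(cR n).
    by case: ifP => // _; rewrite ?mulr1 ?mulr0.
have cy : cR n @[n --> \oo] --> +oo.
  apply/cvgryPge => A.
  exists (Num.truncn A).+1 => // n/= An.
  apply: (le_trans (ltW (truncnS_gt A))); rewrite ler_nat (leq_trans An)//.
  rewrite /c (leq_trans (ltnW (ltn_expl n (isT : (1 < 2)%N))))//.
  by rewrite leq_pmull.
have mlim := cvg_mean_trunc cy.
apply: filterS2 aeD aeE => w Dw Ew.
have Tw : (\sum_(i < c n) t n (X i w)) / cR n @[n --> \oo] -->
    fine (\int[P]_w (h (X 0%N w))%:E).
  pose S n := (\sum_(i < c n) t n (X i w)) / cR n.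
  have dist0 : S n - m n @[n --> \oo] --> 0.
    apply/cvgr0Pnorm_le => eps eps0.
    have /cvgr0Pnorm_le/(_ _ (exprn_gt0 2 eps0)) := Dw.
    apply: filterS => n; rewrite /D normrX.
    by rewrite ler_pXn2r ?nnegrE// ltW.
  have sumlim := cvgD dist0 mlim; rewrite add0r in sumlim.
  rewrite (_ : (fun n => _ / _) = (fun n => S n - m n) \+ m).
    exact: sumlim.
  by apply/funext => n /=; rewrite subrK.
apply: cvg_trans Tw; apply: near_eq_cvg.
have /cvgr0Pnorm_lt/(_ _ ltr01) := Ew.
(* E n is a natural number: once below 1 it vanishes, so nothing is truncated. *)
apply: filterS => n; rewrite ger0_norm ?sumr_ge0// => E1.
rewrite -/(c n) -/(cR n); congr (_ / _); apply: eq_bigr => i _.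
rewrite /t /trunc; case: leP => // ci; exfalso.
move: E1; apply/negP; rewrite -leNgt.
rewrite /E (bigD1 i)//= {1}/e ci lerDl; exact: sumr_ge0.
Unshelve. all: by end_near. Qed.

Theorem strong_law_pairwise : {ae P, forall w,
  (\sum_(i < N) h (X i w)) / N%:R @[N --> \oo] -->
  fine (\int[P]_w (h (X 0%N w))%:E)}.
Proof.
have : {ae P, forall w, forall j, (\sum_(i < j.+1 * 2 ^ n) h (X i w)) /
    (j.+1 * 2 ^ n)%:R @[n --> \oo] --> fine (\int[P]_w (h (X 0%N w))%:E)}.
  by apply/ae_foralln => j; exact: strong_law_dyadic.
apply: filterS => w Hw.
apply: (@cvg_mean_dyadic _ (fun i => h (X i w))) => [i|[//|j] _]; first exact: h0.
exact: Hw.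
Qed.

End StrongLaw.

(** * Kernels and the marginal density *)

Section PositivePdf.
Context {R : realType}.
Variable (k : R).
Hypothesis k0 : 0 < k.

(** Outside of v > 0 the scaled density has no meaning, and may be negative;
    setting it to 0 there allows Tonelli's theorem on the whole plane. *)
Definition positive_pdf (z : R * R) : R :=
  if 0 < z.1 then scaled_chi_square_pdf k z.1 z.2 else 0.

Lemma chi_square_pdf_ge0 x : 0 <= chi_square_pdf k x.
Proof.
rewrite /chi_square_pdf patchE; case: ifP => // _.
apply: divr_ge0; apply: mulr_ge0; rewrite ?powR_ge0 ?expR_ge0//.
by apply: Rintegral_ge0 => t _; rewrite mulr_ge0 ?powR_ge0 ?expR_ge0.
Qed.

Lemma measurable_chi_square_pdf : measurable_fun [set: R] (chi_square_pdf k).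
Proof.
rewrite /chi_square_pdf.
apply/(measurable_restrictT _ (measurable_itv `]0, +oo[)).
apply: measurable_funTS.
apply: measurable_funM => //; apply: measurable_funM => //.
apply: measurableT_comp => //; apply: measurableT_comp => //.
by apply: measurable_funM.
Qed.

Lemma positive_pdf_ge0 z : 0 <= positive_pdf z.
Proof.
rewrite /positive_pdf; case: ifP => // z0.
by rewrite mulr_ge0 ?chi_square_pdf_ge0// divr_ge0 ?ltW.
Qed.

Lemma measurable_positive_pdf : measurable_fun [set: R * R] positive_pdf.
Proof.
have m1 : measurable_fun [set: R * R] (fun z : R * R => z.1 `^ (-1)).
  by apply: (measurableT_comp (measurable_powR _)).
rewrite (_ : positive_pdf = fun z : R * R => if 0 < z.1 then
  k * (z.1 `^ (-1)) * chi_square_pdf k (k * z.2 * (z.1 `^ (-1))) else 0).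
  apply: measurable_fun_ifT => //; first exact: measurable_fun_ltr.
  apply: measurable_funM; first exact: measurable_funM.
  apply: (measurableT_comp measurable_chi_square_pdf).
  by apply: measurable_funM => //; exact: measurable_funM.
apply/funext => z; rewrite /positive_pdf; case: ifP => // z0.
by rewrite powR_inv1 ?ltW.
Qed.

Lemma positive_pdf0 v s : s <= 0 -> positive_pdf (v, s) = 0.
Proof.
move=> s0; rewrite /positive_pdf/=; case: ifP => // v0.
rewrite /scaled_chi_square_pdf /chi_square_pdf patchE ifF ?mulr0//.
apply/negP; rewrite inE/= in_itv/= andbT => /lt_geF/negP; apply.
by rewrite mulr_le0_ge0 ?invr_ge0 ?(ltW v0)// mulr_ge0_le0// ltW.
Qed.

Definition positive_kernel (v : R) (B : set R) : \bar R :=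
  (\int[lebesgue_measure]_(s in B) (positive_pdf (v, s))%:E)%E.

Lemma positive_kernel_ge0 v B : (0 <= positive_kernel v B)%E.
Proof. by apply: integral_ge0 => s _; rewrite lee_fin positive_pdf_ge0. Qed.

Let restricted B (z : R * R) : \bar R :=
  (positive_pdf z * \1_B z.2)%:E.

Let positive_kernelE v B : measurable B ->
  (positive_kernel v B = \int[lebesgue_measure]_s restricted B (v, s))%E.
Proof.
move=> mB; rewrite /positive_kernel integral_mkcond; apply: eq_integral => s _.
by rewrite patchE /restricted/= indicE; case: ifP => _; rewrite ?mulr1 ?mulr0.
Qed.

Let mrestricted B : measurable B -> measurable_fun [set: R * R] (restricted B).
Proof.
move=> mB; apply/measurable_EFinP; apply: measurable_funM.
  exact: measurable_positive_pdf.
by apply: (measurableT_comp (measurable_indic mB)).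
Qed.

Let restricted_ge0 B z : (0 <= restricted B z)%E.
Proof. by rewrite lee_fin mulr_ge0 ?positive_pdf_ge0. Qed.

Lemma measurable_positive_kernel B : measurable B ->
  measurable_fun [set: R] (positive_kernel ^~ B).
Proof.
move=> mB; under eq_fun do rewrite positive_kernelE//.
exact: (measurable_fun_fubini_tonelli_F (m2 := lebesgue_measure) _
  (mrestricted mB) (restricted_ge0 B)).
Qed.

Lemma integral_positive_kernel (g : probability (measurableTypeR R) R) B :
  measurable B ->
  (\int[g]_v positive_kernel v B =
   \int[lebesgue_measure]_(s in B) marginal_pdf k g s)%E.
Proof.
move=> mB; under eq_integral do rewrite positive_kernelE//.
rewrite (fubini_tonelli (m1 := g) (m2 := lebesgue_measure) _ (mrestricted mB))//.
rewrite [RHS]integral_mkcond; apply: eq_integral => s _; rewrite patchE.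
rewrite /restricted/= indicE /marginal_pdf; case: ifP => _; last first.
  by under eq_integral do rewrite mulr0; rewrite integral0.
rewrite [RHS]integral_mkcond; apply: eq_integral => v _.
rewrite mulr1 patchE /positive_pdf/=.
have -> : (v \in (`]0, +oo[%classic : set R)) = (0 < v).
  by apply/idP/idP; rewrite inE/= in_itv/= andbT.
by case: ifP.
Qed.

Lemma marginal_pdf0 (g : probability (measurableTypeR R) R) s : s <= 0 ->
  marginal_pdf k g s = 0%E.
Proof.
move=> s0; apply: integral0_eq => v /=; rewrite in_itv/= andbT => v0.
by have := positive_pdf0 v s0; rewrite /positive_pdf/= v0 => ->.
Qed.

End PositivePdf.

Section BorelCarrier.
Context {R : realType}.

(** Borel measures on the line come over two presentations of the same
    sigma-algebra: R itself, and the type generated by half-open intervals that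
    carries Lebesgue-Stieltjes measures. The two identity maps transport
    measures and integrals from one to the other. *)
Definition from_borel_carrier : measurableTypeR R -> R := idfun.

HB.instance Definition _ :=
  @isMeasurableFun.Build _ _ (measurableTypeR R) R from_borel_carrier
    (@measurable_id _ _ setT).

Definition to_borel_carrier : R -> measurableTypeR R := idfun.

HB.instance Definition _ :=
  @isMeasurableFun.Build _ _ R (measurableTypeR R) to_borel_carrier
    (@measurable_id _ _ setT).

Lemma ge0_integral_from_borel_carrier
    (m : {measure set (measurableTypeR R) -> \bar R})
    (f : R -> \bar R) :
  measurable_fun [set: R] f -> (forall x, 0 <= f x)%E ->
  (\int[pushforward m from_borel_carrier]_x f x = \int[m]_x f x)%E.
Proof. by move=> mf f0; rewrite ge0_integral_pushforward. Qed.

End BorelCarrier.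

Section MarginalLaw.
Context d (T : measurableType d) (R : realType) (P : probability T R).
Variables (k : R) (g : probability (measurableTypeR R) R).
Hypotheses (k0 : 0 < k) (hg : g `]0%R, +oo[%classic = 1%E).
Variables sigma2 s2 : nat -> {RV P >-> R}.
Hypothesis hmodel : hierarchical_model k g sigma2 s2.
Local Open Scope ereal_scope.

Lemma independent_variances i j : i != j ->
  independent_pair (sigma2 i) (sigma2 j).
Proof.
move=> ij A B mA mB; have [+ _ _] := hmodel.
move=> /(_ [:: i; j] (fun l => if l == i then A else B)).
have ji : (j == i) = false by rewrite eq_sym; exact/negbTE.
rewrite big_cons big_seq1 eqxx ji => <-.
- congr (P _); apply/seteqP; split => w /=.
    move=> [wA wB] l /=; rewrite !inE => /orP[|] /eqP ->; first by rewrite eqxx.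
    by rewrite ji.
  move=> H; split; first by have := H i; rewrite /= eqxx !inE eqxx; apply.
  by have := H j; rewrite /= ji !inE eqxx orbT; apply.
- by rewrite /= andbT inE.
- by move=> l; case: ifP.
Qed.

Lemma variance_gt0 i : {ae P, forall w, (0 < sigma2 i w)%R}.
Proof.
have m0 : measurable (`]0%R, +oo[%classic : set R) by exact: measurable_itv.
have [_ hlaw _] := hmodel; have := hlaw i _ m0; rewrite hg => H1.
have compl A : measurable A -> P (sigma2 i @^-1` A) = 1 ->
    P (sigma2 i @^-1` (~` A)) = 0.
  move=> mA A1; rewrite preimage_setC probability_setC ?A1 ?subee//.
  exact: measurable_funPTI.
exists (sigma2 i @^-1` (~` `]0%R, +oo[%classic)); split.
- by apply: measurable_funPTI; exact: measurableC.
- exact: compl.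
- by move=> w /= w0; apply: contra_not w0; rewrite in_itv/= andbT.
Qed.

Lemma sigma_generated_measurable A : sigma_generated sigma2 A -> measurable A.
Proof.
apply: smallest_sub; first exact: sigma_algebra_measurable.
by move=> _ [i [B mB ->]]; exact: measurable_funPTI.
Qed.

(** Conditional probabilities integrate to probabilities; the positive kernel
    agrees with the conditional law because the variances are almost surely
    positive. *)
Lemma law_mixture (J : seq nat) (B : nat -> set R) : uniq J ->
  (forall i, measurable (B i)) ->
  P (\bigcap_(i in [set` J]) s2 i @^-1` B i) =
  \int[P]_w \prod_(i <- J) positive_kernel k (sigma2 i w) (B i).
Proof.
move=> uJ mB; have [_ _ /(_ J B uJ mB)[Ymeas Yint]] := hmodel.
have ST : sigma_generated sigma2 setT.
  have [s0 sC _] := @smallest_sigma_algebra _ setT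
    [set C | exists i, exists2 B : set R, measurable B & C = sigma2 i @^-1` B].
  by rewrite -(setD0 setT); exact: sC.
have := Yint _ ST; rewrite setTI => ->.
apply: ae_eq_integral => //.
- move=> _ E mE; rewrite setTI.
  by apply: sigma_generated_measurable; exact: Ymeas.
- elim: J {uJ Ymeas Yint} => [|i J IH].
    by under eq_fun do rewrite big_nil; exact: measurable_cst.
  under eq_fun do rewrite big_cons; apply: emeasurable_funM; last exact: IH.
  by apply: (measurableT_comp (measurable_positive_kernel k0 (mB i))).
- have /ae_foralln := variance_gt0; apply: filterS => w pos _.
  apply: eq_bigr => i _; apply: eq_integral => s _.
  by rewrite /positive_pdf/= pos.
Qed.

Lemma law_mixture1 i B : measurable B ->
  P (s2 i @^-1` B) = \int[P]_w positive_kernel k (sigma2 i w) B.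
Proof.
move=> mB; have := @law_mixture [:: i] (fun=> B) isT (fun=> mB).
rewrite (_ : \bigcap_(_ in _) _ = s2 i @^-1` B); last first.
  apply/seteqP; split => w /=; last by move=> wB l; rewrite /= inE => /eqP ->.
  by apply; rewrite /= inE.
by move=> ->; under eq_integral do rewrite big_seq1.
Qed.

Lemma law_sample i B : measurable B ->
  P (s2 i @^-1` B) = \int[lebesgue_measure]_(s in B) marginal_pdf k g s.
Proof.
move=> mB; rewrite law_mixture1//.
rewrite -integral_positive_kernel//.
rewrite -(@ge0_integral_distribution _ _ _ _ _ P (sigma2 i)
  (fun v => positive_kernel k v B)); last 2 first.
- exact: measurable_positive_kernel.
- by move=> v; exact: positive_kernel_ge0.
rewrite -(ge0_integral_from_borel_carrier _ (measurable_positive_kernel k0 mB)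
  (fun v => positive_kernel_ge0 k0 v B)).
by apply: eq_measure_integral => A mA _; have [_ /(_ i A mA) + _] := hmodel.
Qed.

(** The kernels are evaluated at independent variances, so the expectation of
    their product factors. *)
Lemma pairwise_independent_sample : pairwise_independent s2.
Proof.
move=> i j ij A B mA mB.
have ji : (j == i) = false by rewrite eq_sym; exact/negbTE.
pose C l := if l == i then A else B.
have mC l : measurable (C l) by rewrite /C; case: ifP.
have uij : uniq [:: i; j] by rewrite /= andbT inE.
have := @law_mixture [:: i; j] C uij mC.
rewrite (_ : \bigcap_(_ in _) _ = s2 i @^-1` A `&` s2 j @^-1` B); last first.
  apply/seteqP; split => w /=.
    move=> H; split; first by have := H i; rewrite /= /C eqxx !inE eqxx; apply.
    by have := H j; rewrite /= /C ji !inE eqxx orbT; apply.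
  move=> [wA wB] l /=; rewrite /C !inE => /orP[|] /eqP ->; first by rewrite eqxx.
  by rewrite ji.
move=> ->; rewrite (law_mixture1 i mA) (law_mixture1 j mB).
under eq_integral do rewrite big_cons big_seq1 /C eqxx ji.
apply: (@ge0_integral_independentM _ _ _ P _ _ _ _ (sigma2 i) (sigma2 j)
  (fun v => positive_kernel k v A) (fun v => positive_kernel k v B)).
- exact: independent_variances.
- exact: measurable_positive_kernel.
- exact: measurable_positive_kernel.
- by move=> v; exact: positive_kernel_ge0.
- by move=> v; exact: positive_kernel_ge0.
Qed.

Lemma identically_distributed_sample : identically_distributed s2.
Proof. by move=> i A mA; rewrite !law_sample. Qed.

(** It suffices to compare the measures of half-open intervals, differences of
    half-lines; and half-lines have measure F x since marginal_pdf vanishes on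
    nonpositive reals. *)
Lemma law_sample_stieltjes (F : cumulative R R) i B :
  (forall x : R, (F x)%:E = marginal_cdf k g x) -> measurable B ->
  lebesgue_stieltjes_measure F B = P (s2 i @^-1` B).
Proof.
move=> hF mB.
have PF x : distribution P (s2 i) `]-oo, x]%classic = (F x)%:E.
  rewrite /distribution /pushforward law_sample// hF /marginal_cdf.
  rewrite integral_mkcond [RHS]integral_mkcond; apply: eq_integral => s _.
  rewrite !patchE.
  have -> : (s \in (`]-oo, x]%classic : set R)) = (s <= x)%R.
    by apply/idP/idP; rewrite inE/= in_itv.
  have -> : (s \in (`]0%R, x]%classic : set R)) = (0 < s <= x)%R.
    by apply/idP/idP; rewrite inE/= in_itv.
  have [s0|s0] := ltP 0%R s; first by [].
  by rewrite marginal_pdf0//; case: ifP.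
have PF2 a b : (a <= b)%R ->
    distribution P (s2 i) `]a, b]%classic = (F b)%:E - (F a)%:E.
  move=> ab.
  have -> : (`]a, b] = `]-oo, b] `\` `]-oo, a])%classic.
    apply/seteqP; split => x /=; rewrite !in_itv/=.
      by move=> /andP[ax xb]; split => //; apply/negP; rewrite -ltNge.
    by move=> [xb /negP]; rewrite -ltNge xb andbT.
  rewrite measureD//=; last by rewrite -/(distribution P (s2 i) _) PF ltry.
  rewrite (_ : (`]-oo, b] `&` `]-oo, a])%classic = `]-oo, a]%classic).
    by rewrite -!/(distribution P (s2 i) _) !PF.
  apply/seteqP; split => x /=; rewrite !in_itv/=; first by case.
  by move=> xa; split => //; exact: le_trans ab.
apply: (@lebesgue_stieltjes_measure_unique _ F
  (pushforward (distribution P (s2 i)) to_borel_carrier) _ B mB).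
move=> _ [[a b] _ <-] /=.
rewrite /lebesgue_stieltjes_measure /measure_extension/=.
rewrite measurable_mu_extE/=; last exact: is_ocitv.
have [ab | ba] := leP a b; last first.
  by rewrite set_itv_ge ?wlength0 ?measure0// bnd_simp -leNgt ltW.
by rewrite wlength_itv_bnd// EFinB -PF2.
Qed.

End MarginalLaw.

(** * Uniform convergence of monotone functions and of tail means *)

Section Polya.
Context {R : realType}.

(** Between two rational points where GN N is close to G and G varies little,
    monotonicity traps both functions; compactness leaves finitely many such
    pairs. The point q > u, obtained for free from the same trap, is used to
    find a sample value strictly above u. *)
Lemma polya_uniform (GN : nat -> R -> R) (G : R -> R) :
  (forall N, {homo GN N : u v /~ u <= v}) -> {homo G : u v /~ u <= v} ->
  (forall u e : R, 0 < e -> exists a b, [/\ a < u, u < b & G a - G b <= e]) ->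
  (forall q : rat, GN N (ratr q) @[N --> \oo] --> G (ratr q)) ->
  forall a b e : R, 0 < e -> \forall N \near \oo, forall u, a <= u <= b ->
    `|GN N u - G u| <= e /\ exists2 q, u < q & `|GN N q - G u| <= e.
Proof.
move=> GNd Gd Gc GNq a b e e0.
pose good (N : nat) (u : R) :=
  `|GN N u - G u| <= e /\ exists2 q, u < q & `|GN N q - G u| <= e.
have : near_covering `[a, b]%classic.
  by apply/compact_near_coveringP; exact: segment_compact.
move=> /(_ _ \oo%classic good _) cov.
suff : \forall N \near \oo, `[a, b]%classic `<=` good N.
  by apply: filterS => N sub u uab; apply: sub; rewrite /= in_itv.
apply: cov => u _.
have [x [y [xu uy Gxy]]] := Gc u (e / 2) (divr_gt0 e0 (ltr0Sn R 1)).
have [r] := rat_in_itvoo xu; rewrite in_itv/= => /andP[xr ru].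
have [r'] := rat_in_itvoo uy; rewrite in_itv/= => /andP[ur' r'y].
have /cvgrPdist_le/(_ _ (divr_gt0 e0 (ltr0Sn R 1))) Hr := GNq r.
have /cvgrPdist_le/(_ _ (divr_gt0 e0 (ltr0Sn R 1))) Hr' := GNq r'.
have Grr' : G (ratr r) - G (ratr r') <= e / 2.
  apply: le_trans Gxy; have := Gd _ _ (ltW xr); have := Gd _ _ (ltW r'y).
  by lra.
exists ([set v | ratr r < v < ratr r']%R,
  [set N | `|G (ratr r) - GN N (ratr r)| <= e / 2 /\
           `|G (ratr r') - GN N (ratr r')| <= e / 2]) => /=.
  split; last exact: filterI.
  have : `]ratr r, ratr r'[%classic u by rewrite /= in_itv/= ru.
  by move/(near_in_itvoo); apply: filterS => v /=; rewrite in_itv.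
move=> [v N]/= [/andP[rv vr']]; rewrite !ler_norml.
move=> -[/andP[r1 r2] /andP[r3 r4]].
have g1 := Gd _ _ (ltW rv); have g2 := Gd _ _ (ltW vr').
have g3 := GNd N _ _ (ltW rv); have g4 := GNd N _ _ (ltW vr').
split; first by rewrite ler_norml; apply/andP; split; lra.
by exists (ratr r') => //; rewrite ler_norml; apply/andP; split; lra.
Qed.

End Polya.

Section TailMeans.
Context d (T : measurableType d) (R : realType) (P : probability T R).

(** The condition 0 < s makes the weight at u = 0 dominate all the others, those
    with u < 0 included. *)
Definition tail_weight (p u s : R) : R :=
  if (0 < s) && (u <= s) then s `^ p else 0.

Definition tail_mean (p : R) (x : nat -> R) N u : R :=
  (\sum_(i < N) tail_weight p u (x i)) / N%:R.

Definition tail_expectation (p : R) (X : {RV P >-> R}) u : R :=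
  fine (\int[P]_w (tail_weight p u (X w))%:E).

Lemma tail_weight_ge0 p u s : 0 <= tail_weight p u s.
Proof. by rewrite /tail_weight; case: ifP => // _; exact: powR_ge0. Qed.

Lemma measurable_tail_weight p u : measurable_fun [set: R] (tail_weight p u).
Proof.
apply: measurable_fun_ifT => //.
apply: measurable_and; [exact: measurable_fun_ltr|exact: measurable_fun_ler].
Qed.

Lemma tail_weight_anti p s u v : u <= v -> tail_weight p v s <= tail_weight p u s.
Proof.
move=> uv; rewrite /tail_weight; case: ltP => //= s0.
case: (leP v s) => vs; first by rewrite (le_trans uv vs).
by case: ifP => // _; exact: powR_ge0.
Qed.

Lemma tail_mean_anti p x N : {homo tail_mean p x N : u v /~ u <= v}.
Proof.
move=> u v uv; rewrite ler_wpM2r ?invr_ge0// ler_sum// => i _.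
exact: tail_weight_anti.
Qed.

Lemma tail_weight_le p u s : tail_weight p u s <= tail_weight p 0 s.
Proof.
rewrite /tail_weight; case: ltP => //= s0; rewrite (ltW s0).
by case: ifP => // _; exact: powR_ge0.
Qed.

Section TailExpectation.
Variables (p : R) (X : {RV P >-> R}).
Hypothesis Xfin : (\int[P]_w (tail_weight p 0 (X w))%:E < +oo)%E.

Lemma measurable_tail_weight_RV u :
  measurable_fun [set: T] (fun w => (tail_weight p u (X w))%:E).
Proof.
apply/measurable_EFinP; apply: measurableT_comp => //.
exact: measurable_tail_weight.
Qed.

Lemma tail_expectation_fin u :
  (\int[P]_w (tail_weight p u (X w))%:E)%E \is a fin_num.
Proof.
rewrite ge0_fin_numE; last first.
  by apply: integral_ge0 => w _; rewrite lee_fin tail_weight_ge0.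
apply: le_lt_trans Xfin; apply: ge0_le_integral => //.
- by move=> w _; rewrite lee_fin tail_weight_ge0.
- exact: measurable_tail_weight_RV.
- exact: measurable_tail_weight_RV.
- by move=> w _; rewrite lee_fin tail_weight_le.
Qed.

Lemma tail_expectation_anti : {homo tail_expectation p X : u v /~ u <= v}.
Proof.
move=> u v uv; apply: fine_le; rewrite ?tail_expectation_fin//.
apply: ge0_le_integral => //.
- by move=> w _; rewrite lee_fin tail_weight_ge0.
- exact: measurable_tail_weight_RV.
- exact: measurable_tail_weight_RV.
- by move=> w _; rewrite lee_fin tail_weight_anti.
Qed.

(** Dominated convergence; all tail weights are bounded by the one at 0. *)
Lemma cvg_tail_expectation (v : nat -> R) (l : R -> R) :
  measurable_fun [set: R] l ->
  {ae P, forall w, \forall n \near \oo, tail_weight p (v n) (X w) = l (X w)} ->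
  tail_expectation p X (v n) @[n --> \oo] --> fine (\int[P]_w (l (X w))%:E).
Proof.
move=> ml vl; apply: fine_cvg.
have ilim : P.-integrable [set: T] (fun w => (tail_weight p 0 (X w))%:E).
  apply/integrableP; split; first exact: measurable_tail_weight_RV.
  by under eq_integral do rewrite gee0_abs ?lee_fin ?tail_weight_ge0//.
have [//|||||il _ ] := @dominated_convergence _ _ _ P _ measurableT
  (fun n w => (tail_weight p (v n) (X w))%:E) (fun w => (l (X w))%:E)
  (fun w => (tail_weight p 0 (X w))%:E).
- by move=> n; exact: measurable_tail_weight_RV.
- by apply/measurable_EFinP; exact: measurableT_comp.
- apply: filterS vl => w vlw _; apply: cvg_near_cst.
  by apply: filterS vlw => n ->.
- exact: ilim.
- apply: aeW => w n _.
  by rewrite gee0_abs ?lee_fin ?tail_weight_ge0// tail_weight_le.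
by rewrite fineK ?integrable_fin_num.
Qed.

Lemma tail_expectation_vanishes : tail_expectation p X n%:R @[n --> \oo] --> 0.
Proof.
have -> : 0 = fine (\int[P]_w ((fun=> 0 : R) (X w))%:E) by rewrite integral0.
apply: (@cvg_tail_expectation (fun n => n%:R) (fun=> 0)) => //.
apply: aeW => w; near=> n.
rewrite /tail_weight ifF// [_ <= _]leNgt (_ : X w < n%:R) ?andbF//.
by near: n; exact: nbhs_infty_gtr.
Unshelve. all: by end_near. Qed.

Hypothesis Xatomless : forall u, P (X @^-1` [set u]) = 0%E.

Lemma tail_expectation_continuous (u e : R) : 0 < e ->
  exists a b, [/\ a < u, u < b &
    tail_expectation p X a - tail_expectation p X b <= e].
Proof.
move=> e0.
have neq_u : {ae P, forall w, X w != u}.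
  exists (X @^-1` [set u]); split; [exact: measurable_funPTI|exact: Xatomless|].
  by move=> w /= /negP; rewrite negbK => /eqP.
have cvg_u (v : nat -> R) : v n @[n --> \oo] --> u ->
    tail_expectation p X (v n) @[n --> \oo] --> tail_expectation p X u.
  move=> vu; apply: cvg_tail_expectation; first exact: measurable_tail_weight.
  apply: filterS neq_u => w; rewrite neq_lt => /orP[Xu|uX].
    near=> n; rewrite /tail_weight.
    rewrite (_ : v n <= X w = false) 1?(_ : u <= X w = false)//.
      by apply/negbTE; rewrite -ltNge.
    by apply/negbTE; rewrite -ltNge; near: n; exact: cvgr_gt Xu.
  near=> n; rewrite /tail_weight (ltW uX) (_ : v n <= X w)//.
  by near: n; exact: cvgr_le uX.
have harm : n.+1%:R^-1 @[n --> \oo] --> (0 : R) by exact: cvg_harmonic.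
have lo : (u - n.+1%:R^-1) @[n --> \oo] --> u.
  by rewrite -[X in _ --> X]subr0; apply: cvgB => //; exact: cvg_cst.
have hi : (u + n.+1%:R^-1) @[n --> \oo] --> u.
  by rewrite -[X in _ --> X]addr0; apply: cvgD => //; exact: cvg_cst.
have /cvgrPdist_le/(_ _ (divr_gt0 e0 (ltr0Sn R 1))) Hlo := cvg_u _ lo.
have /cvgrPdist_le/(_ _ (divr_gt0 e0 (ltr0Sn R 1))) Hhi := cvg_u _ hi.
have [n [h1 h2]] := filter_ex (filterI Hlo Hhi).
exists (u - n.+1%:R^-1), (u + n.+1%:R^-1); split.
- by rewrite ltrBlDr ltrDl invr_gt0.
- by rewrite ltrDl invr_gt0.
- by move: h1 h2; rewrite !ler_norml => /andP[? ?] /andP[? ?]; lra.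
Unshelve. all: by end_near. Qed.

End TailExpectation.

Lemma ae_tail_mean_uniform (p : R) (X : nat -> {RV P >-> R}) :
  pairwise_independent X -> identically_distributed X ->
  (\int[P]_w (tail_weight p 0 (X 0%N w))%:E < +oo)%E ->
  (forall u, P (X 0%N @^-1` [set u]) = 0%E) ->
  {ae P, forall w, forall a b e : R, 0 < e ->
    \forall N \near \oo, forall u, a <= u <= b ->
    `|tail_mean p (X ^~ w) N u - tail_expectation p (X 0%N) u| <= e /\
    exists2 q, u < q &
      `|tail_mean p (X ^~ w) N q - tail_expectation p (X 0%N) u| <= e}.
Proof.
move=> Xind Xid Xfin Xatomless.
have ae_q (q : R) : {ae P, forall w, tail_mean p (X ^~ w) N q @[N --> \oo] -->
    tail_expectation p (X 0%N) q}.
  apply: strong_law_pairwise => //.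
  - exact: measurable_tail_weight.
  - by move=> s; exact: tail_weight_ge0.
  - rewrite ltey_eq; apply/orP; left; exact: tail_expectation_fin.
have /ae_foralln := fun n => ae_q (ratr (odflt 0%Q (unpickle n : option rat))).
apply: filterS => w Hw.
apply: polya_uniform.
- by move=> N; exact: tail_mean_anti.
- exact: tail_expectation_anti.
- by move=> u e e0; exact: tail_expectation_continuous.
- by move=> q; have := Hw (pickle q); rewrite pickleK.
Qed.

End TailMeans.

(** * From tail means to the estimators *)

Section SupOver.
Context {R : realType}.

Lemma sup_over_bounds (D : set R) (h : R -> R) (e : R) : 0 <= e ->
  (forall u, 0 <= h u) -> (forall u, D u -> h u <= e) ->
  (0 <= sup_over D h <= e%:E)%E.
Proof.
move=> e0 h0 he; rewrite /sup_over; case: ifPn => [_|/set0P[u Du]].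
  by rewrite lexx lee_fin.
apply/andP; split; last by apply: ge_ereal_sup => _ [v Dv <-]; rewrite lee_fin he.
by apply: le_ereal_sup_tmp; exists (h u)%:E; [exists u|rewrite lee_fin].
Qed.

Lemma cvg0_sup_over (D : set R) (h : nat -> R -> R) :
  (forall N u, 0 <= h N u) ->
  (forall e : R, 0 < e -> \forall N \near \oo, forall u, D u -> h N u <= e) ->
  sup_over D (h N) @[N --> \oo] --> 0%E.
Proof.
move=> h0 he.
have bnd (e : R) : 0 < e ->
    \forall N \near \oo, (0 <= sup_over D (h N) <= e%:E)%E.
  move=> e0; apply: filterS (he e e0) => N heN.
  by apply: sup_over_bounds => //; exact: ltW.
apply/fine_cvgP; split.
  apply: filterS (bnd 1 ltr01) => N /andP[s0 s1].
  by rewrite ge0_fin_numE// (le_lt_trans s1)// ltry.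
apply/cvgr0Pnorm_le => e e0; apply: filterS (bnd e e0) => N /= /andP[s0 s1].
rewrite ger0_norm ?fine_ge0// -lee_fin fineK//.
by rewrite ge0_fin_numE// (le_lt_trans s1)// ltry.
Qed.

Lemma ratio_dist_le (A B A' B' M delta e : R) : 0 < delta -> delta < B ->
  0 <= A <= M -> `|A' - A| <= e -> `|B' - B| <= e -> e <= delta / 2 ->
  `|A' / B' - A / B| <= e * (2 / delta + 2 * M / delta ^+ 2).
Proof.
move=> d0 dB /andP[A0 AM] HA HB ed.
have e0 : 0 <= e by exact: le_trans HA.
have B0 : 0 < B by exact: lt_trans dB.
have dB' : delta / 2 <= B'.
  by move: HB; rewrite ler_norml => /andP[? ?]; lra.
have B'0 : 0 < B' by apply: lt_le_trans dB'; rewrite divr_gt0.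
have -> : A' / B' - A / B = (A' - A) / B' + A * (B - B') / (B * B').
  by field; rewrite !gt_eqF.
apply: le_trans (ler_normD _ _) _; rewrite [leRHS]mulrDr; apply: lerD.
  rewrite normrM normfV (gtr0_norm B'0) ler_pdivrMr//.
  apply: (le_trans HA); rewrite -mulrA ler_peMr// mulrAC ler_pdivlMr// mul1r.
  lra.
rewrite !normrM normfV normrM (gtr0_norm B'0) (gtr0_norm B0) (ger0_norm A0).
rewrite distrC ler_pdivrMr ?mulr_gt0//.
have BB' : delta ^+ 2 / 2 <= B * B'.
  rewrite expr2 -mulrA; apply: ler_pM => //; try exact: ltW.
  by rewrite divr_ge0// ltW.
apply: (@le_trans _ _ (M * e)).
  by apply: ler_pM.
have M0 : 0 <= M by exact: le_trans AM.
have -> : M * e = e * (2 * M / delta ^+ 2) * (delta ^+ 2 / 2).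
  by field; rewrite gt_eqF.
apply: ler_wpM2l => //; apply: mulr_ge0 => //.
by apply: divr_ge0; [exact: mulr_ge0|exact: sqr_ge0].
Qed.

End SupOver.

Section Estimators.
Context {R : realType}.

(** A sample value above u excludes the first branch, and the factor 1 / N cancels
    in the ratio. *)
Lemma F_EBV_estE (k : R) N (x : nat -> R) u : 0 < u ->
  (exists j : 'I_N, u < x j) ->
  F_EBV_est k N x u =
    k / 2 * (tail_mean (- (k / 2 - 2)) x N u /
             tail_mean (- (k / 2 - 1)) x N u - u).
Proof.
move=> u0 [j uj]; rewrite /F_EBV_est ifF; last first.
  apply/negbTE; rewrite -ltNge; apply: (lt_le_trans uj).
  exact: (le_bigmax_cond _ (fun i : 'I_N => x i)).
have N0 : N%:R != 0 :> R by rewrite pnatr_eq0 -lt0n (leq_trans _ (ltn_ord j)).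
have tailE p : \sum_(i < N | u <= x i) x i `^ p = tail_mean p x N u * N%:R.
  rewrite divfK// big_mkcond/=; apply: eq_bigr => i _; rewrite /tail_weight.
  by case: (leP u (x i)) => [ux|]; rewrite ?andbF// (lt_le_trans u0 ux).
by rewrite !tailE -mulf_div divff// mulr1.
Qed.

Lemma tail_mean_gt0_exists (p : R) (x : nat -> R) N q : 0 < tail_mean p x N q ->
  exists j : 'I_N, q <= x j.
Proof.
move=> H; apply/existsP; apply: contraPT H => /existsPn nex.
rewrite /tail_mean big1 ?mul0r ?ltxx// => j _.
by rewrite /tail_weight (negbTE (nex j)) andbF.
Qed.

End Estimators.

Section SampleIntegrals.
Context d (T : measurableType d) (R : realType) (P : probability T R).
Variables (X : {RV P >-> R}) (F : cumulative R R).
Hypothesis XF : forall B : set R, measurable B ->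
  lebesgue_stieltjes_measure F B = P (X @^-1` B).
Hypothesis Xatomless : forall u, P (X @^-1` [set u]) = 0%E.

(** The two sides differ by the treatment of s = u, which is a null event. *)
Lemma tail_expectation_stieltjes (p u : R) : 0 <= u ->
  (\int[P]_w (tail_weight p u (X w))%:E =
   \int[lebesgue_stieltjes_measure F]_(s in `]u, +oo[) (s `^ p)%:E)%E.
Proof.
move=> u0.
pose f (s : R) := (if u < s then s `^ p else 0)%:E.
have mf : measurable_fun [set: R] f.
  apply/measurable_EFinP; apply: measurable_fun_ifT => //.
  exact: measurable_fun_ltr.
have f0 s : (0 <= f s)%E.
  by rewrite /f lee_fin; case: ifP => // _; exact: powR_ge0.
transitivity (\int[P]_w f (X w))%E.
  apply: ge0_ae_eq_integral => //.
  - exact: measurable_tail_weight_RV.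
  - exact: measurableT_comp.
  - by move=> w _; rewrite lee_fin tail_weight_ge0.
  exists (X @^-1` [set u]); split; [exact: measurable_funPTI|exact: Xatomless|].
  move=> w /= H; apply: contrapT => /eqP Xu; apply: H => _.
  rewrite /f /tail_weight le_eqVlt eq_sym (negbTE Xu)/=.
  by case: (ltP u (X w)) => [uX|_]; rewrite ?andbF// (le_lt_trans u0 uX).
transitivity (\int[distribution P X]_s f s)%E.
  by rewrite ge0_integral_distribution.
rewrite [RHS]integral_mkcond.
transitivity (\int[pushforward (lebesgue_stieltjes_measure F)
    (@from_borel_carrier R)]_s f s)%E.
  by apply: eq_measure_integral => A mA _; rewrite [RHS]XF.
rewrite ge0_integral_from_borel_carrier//; apply: eq_integral => s _.
rewrite patchE /f.
have -> : (s \in (`]u, +oo[%classic : set R)) = (u < s).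
  by apply/idP/idP; rewrite inE/= in_itv/= andbT.
by case: ifP.
Qed.

End SampleIntegrals.

Theorem theorem3p2 (R : realType) (d : measure_display) (T : measurableType d)
  (P : probability T R) (k : R) (hk : 0 < k)
  (g : probability (measurableTypeR R) R) (hg : g `]0%R, +oo[%classic = 1%E)
  (sigma2 s2 : nat -> {RV P >-> R})
  (hmodel : hierarchical_model k g sigma2 s2)
  (F : cumulative R R) (hF : forall x : R, (F x)%:E = marginal_cdf k g x)
  (hint2 : (\int[lebesgue_stieltjes_measure F]_(s in `]0%R, +oo[)
              (s `^ (- (k / 2 - 2)))%:E < +oo)%E)
  (hint1 : (\int[lebesgue_stieltjes_measure F]_(s in `]0%R, +oo[)
              (s `^ (- (k / 2 - 1)))%:E < +oo)%E)
  (hcont : continuous F)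
  (hsupp : has_support (lebesgue_stieltjes_measure F) `]0, +oo[%classic)
  (delta : R) (hdelta : 0 < delta) :
  {ae P, forall w,
    (fun N : nat => sup_over (D_delta k F delta)
       (fun u => `|F_EBV_est k N (fun i => s2 i w) u - bayes_est k F u|))
    @ \oo --> 0%E}.
Proof.
have law i B : measurable B ->
    lebesgue_stieltjes_measure F B = P (s2 i @^-1` B).
  by move=> mB; exact: (law_sample_stieltjes hk hg hmodel).
have atomless u : P (s2 0%N @^-1` [set u]) = 0%E.
  by rewrite (law_sample hk hg hmodel)// integral_set1.
have tailE p := tail_expectation_stieltjes (law 0%N) atomless p.
set a := - (k / 2 - 2) in hint2; set b := - (k / 2 - 1) in hint1.
have afin : (\int[P]_w (tail_weight a 0 (s2 0%N w))%:E < +oo)%E by rewrite tailE.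
have bfin : (\int[P]_w (tail_weight b 0 (s2 0%N w))%:E < +oo)%E by rewrite tailE.
have Xind := pairwise_independent_sample hk hg hmodel.
have Xid := identically_distributed_sample hk hg hmodel.
pose A := tail_expectation a (s2 0%N); pose B := tail_expectation b (s2 0%N).
pose M := A 0.
have AM u : 0 <= u -> 0 <= A u <= M.
  move=> u0; rewrite tail_expectation_anti// andbT.
  by rewrite fine_ge0// integral_ge0// => w _; rewrite lee_fin tail_weight_ge0.
have bayesE u : 0 <= u -> bayes_est k F u = k / 2 * (A u / B u - u).
  by move=> u0; rewrite /bayes_est /Rintegral -!tailE.
have DB u : D_delta k F delta u -> 0 < u /\ delta < B u.
  move=> [u0]; rewrite -tailE ?(ltW u0)// => dB; split => //.
  by rewrite -lte_fin fineK// tail_expectation_fin.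
have [n Bn] : exists n, B n%:R < delta.
  have /cvgrPdist_lt/(_ _ hdelta)[n _ Hn] := tail_expectation_vanishes bfin.
  exists n; have := Hn n (leqnn n); rewrite sub0r normrN.
  exact: le_lt_trans (ler_norm _).
have Dn u : D_delta k F delta u -> 0 <= u <= n%:R.
  move=> /DB[u0 dB]; rewrite (ltW u0) leNgt; apply/negP => nu.
  have := tail_expectation_anti bfin (ltW nu); rewrite -/(B _) -/(B _) => Bu.
  by have := lt_trans dB (le_lt_trans Bu Bn); rewrite ltxx.
have aeA := ae_tail_mean_uniform Xind Xid afin atomless.
have aeB := ae_tail_mean_uniform Xind Xid bfin atomless.
apply: filterS2 aeA aeB => w unifA unifB.
apply: cvg0_sup_over => // e e0.
pose C := k / 2 * (2 / delta + 2 * M / delta ^+ 2).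
have C0 : 0 < C.
  have /andP[_ M0] := AM 0 (lexx 0).
  rewrite mulr_gt0 ?divr_gt0// ltr_wpDr ?divr_gt0// divr_ge0 ?sqr_ge0//.
  by rewrite mulr_ge0//; have /andP[] := AM 0 (lexx 0).
pose e' := Num.min (delta / 2) (e / C).
have e'0 : 0 < e' by rewrite lt_min !divr_gt0.
have e'd : e' <= delta / 2 by rewrite ge_min lexx.
have e'C : e' <= e / C by rewrite ge_min lexx orbT.
apply: filterS2 (unifA 0 n%:R e' e'0) (unifB 0 n%:R e' e'0) => N HA HB u Du.
have [u0 dB] := DB u Du.
have [HAu _] := HA u (Dn u Du); have [HBu [q uq HBq]] := HB u (Dn u Du).
(* The tail mean at q is at least B u - delta / 2 > 0. *)
have [j qj] : exists j : 'I_N, q <= s2 j w.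
  apply: (@tail_mean_gt0_exists _ b (s2 ^~ w)).
  move: HBq; rewrite ler_norml -/(B u) => /andP[? _]; lra.
rewrite F_EBV_estE//; last by exists j; exact: lt_le_trans qj.
rewrite (bayesE u (ltW u0)) -/a -/b.
have cancel (x y z : R) : k / 2 * (x - z) - k / 2 * (y - z) = k / 2 * (x - y).
  by ring.
rewrite cancel normrM gtr0_norm ?divr_gt0//.
apply: (@le_trans _ _ (k / 2 * (e' * (2 / delta + 2 * M / delta ^+ 2)))).
  rewrite ler_pM2l ?divr_gt0//.
  exact: (ratio_dist_le hdelta dB (AM u (ltW u0)) HAu HBu e'd).
by rewrite mulrCA -/C -ler_pdivlMr.
Qed.
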